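(* Let $T(z)=\sum_{k=-n}^{n} a_k z^k$ be a trigonometric polynomial of degree $n$ with complex coefficients. Then $$\Vert T'\Vert_0\le n\,\Vert T\Vert_0 .$$
   Context: Let $\mathbb{T}=\{z\in\mathbb{C}:|z|=1\}$ and let $m$ be the normalized Haar measure on $\mathbb{T}$, i.e. $\int_{\mathbb{T}} f\,dm=\int_0^1 f(e^{2i\pi\theta})\,d\theta$. The Mahler norm of $f$ is $\Vert f\Vert_0=\exp\big(\int_{\mathbb{T}}\log|f|\,dm\big)$, with the convention $\exp(-\infty)=0$. The derivative $T'$ may be taken either with respect to $z$, or with respect to $x$ where $z=e^{ix}$: on $\mathbb{T}$ the two derivatives have the same modulus, so $\Vert T'\Vert_0$ is the same. *)

(* Defs.v *)
From HB Require Import structures.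
From mathcomp Require Import all_boot all_order all_algebra.
From mathcomp Require Import all_classical all_reals all_analysis.
From mathcomp Require Import complex.

Set Implicit Arguments.
Unset Strict Implicit.
Unset Printing Implicit Defensive.

Import Order.TTheory GRing.Theory Num.Theory.
Import numFieldNormedType.Exports.

Local Open Scope ring_scope.
Local Open Scope classical_set_scope.
Local Open Scope complex_scope.

(* The point e^{2 i pi theta} of the unit circle. *)
Definition circle_point (R : realType) (theta : R) : R[i] :=
  cos (2 * pi * theta) +i* sin (2 * pi * theta).

(* The normalized Haar measure on the circle is the image of the Lebesgue
   measure on [0, 1] under circle_point.  Since lne 0 = -oo and
   expeR -oo = 0, the value is 0 when the integral of log|f| diverges
   to -oo, in particular for f = 0. *)
Definition mahler_norm (R : realType) (f : R[i] -> R[i]) : \bar R :=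
  expeR (\int[lebesgue_measure]_(theta in `[0%R, 1%R])
    lne (ComplexField.Normc.normc (f (circle_point theta)))%:E)%E.

(* The sum of a_k z^k over -n <= k <= n, reindexed by k = j - n; only the
   values of a on [-n, n] matter.  No coefficient is required to be nonzero,
   so the degree is at most n. *)
Definition trig_poly (R : realType) (n : nat) (a : int -> R[i]) (z : R[i]) :
    R[i] :=
  \sum_(j < n.*2.+1) a (j%:Z - n%:Z) * z ^ (j%:Z - n%:Z).

(* The complex derivative: derive1 taken over the field R[i], with R[i]
   as a normed module over itself. *)
Definition complex_deriv (R : realType) (f : R[i] -> R[i]) : R[i] -> R[i] :=
  @derive1 R[i] R[i]^o f.

(* Main.v *)
(* On the circle |T'(z)| = |A p (z)|, where p = z^n T has degree at most 2n and
A p = z p' - n p.  Off the roots, A p / p is the sum over the 2n roots al of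
p (some possibly at infinity) of w(al) = z/(z - al) - 1/2.  For |z| = 1,
reflecting al in the circle keeps Im w(al) and changes the sign of Re w(al),
which is nonnegative exactly when |al| <= 1.  So if q is obtained from p by
reflecting into the disc all roots outside it, normalised so that |q| = |p| on
the circle, then |A p| <= |A q| there.  All roots of q and of A q lie in the
closed disc, since Re (A q / q) > 0 outside it, and the integral of log|f| over
the circle is then log|lead_coef f|; as lead_coef (A q) = n lead_coef q, the
inequality follows.

The integral of log|z - al| vanishes for |al| <= 1: for |al| < 1 the identity
z^2 - al^2 = (z - al)(z + al) gives I(al^2) = 2 I(al), and I is bounded on
|al| <= r < 1; the case |al| = 1 follows by letting r al tend to al, r < 1.
*)

Require Import Defs.
From mathcomp Require Import all_boot all_order all_algebra.
From mathcomp Require Import all_classical all_reals all_analysis.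
From mathcomp Require Import measurable_realfun.
From mathcomp Require Import complex.
From mathcomp Require Import ring lra.

Set Implicit Arguments.
Unset Strict Implicit.
Unset Printing Implicit Defensive.

Import Order.TTheory GRing.Theory Num.Theory.
Import numFieldNormedType.Exports.
Import ComplexField.Normc.

Local Open Scope ring_scope.
Local Open Scope classical_set_scope.
Local Open Scope complex_scope.


(** * Periodic functions *)

(** By periodicity [F (x + 1) - F x] has derivative zero, so the mean value theorem makes it
    constant. Integrating from -1 makes [F] differentiable on both sides of 0. *)
Lemma periodic_antiderivative (R : realType) (g : R -> R) :
  continuous g -> (forall x, g (x + 1) = g x) ->
  exists F : R -> R, (forall x : R, -1 < x -> is_derive x (1 : R) F (g x)) /\
    (forall x : R, 0 <= x -> F (x + 1) - F x = F 1 - F 0).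
Proof.
move=> cg pg.
pose F x := (\int[@lebesgue_measure R]_(t in `[(-1)%R, x]) g t)%R.
have F' (x : R) : -1 < x -> is_derive x (1 : R) F (g x).
  move=> x1; have xu : x < x + 1 by rewrite ltrDl.
  have ig : (@lebesgue_measure R).-integrable `[(-1)%R, x + 1] (EFin \o g).
    apply: continuous_compact_integrable; first exact: segment_compact.
    exact: continuous_subspaceT.
  have [dF FE] := continuous_FTC1_closed xu ig x1 (cg x).
  split; [exact: dF|rewrite -derive1E; exact: FE].
exists F; split=> // x; rewrite le_eqVlt => /predU1P[<-|x0]; first by rewrite add0r.
pose H y := F (y + 1) - F y.
have H' (y : R) : -1 < y -> is_derive y (1 : R) H 0.
  move=> y1; have y2 : -1 < y + 1 by lra.
  have -> : 0 = g (y + 1) * 1 - g y by rewrite pg mulr1 subrr.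
  have Fy := F' _ y1; have Fy1 := F' _ y2.
  apply: is_deriveB.
  apply: (@is_derive1_comp _ F (fun y => y + 1)) => //.
  by apply: is_derive_eq; rewrite addr0.
have cH y : -1 < y -> {for y, continuous H}.
  move=> y1; apply/differentiable_continuous/derivable1_diffP.
  by have [] := H' _ y1.
have := @MVT_segment R H (cst 0) 0 x (ltW x0) _ _.
case=> [y| |y _].
- rewrite in_itv/= => /andP[y0 _]; apply: H'; lra.
- apply: continuous_in_subspaceT => y /[!inE]/= /andP[y0 _].
  apply: cH; rewrite ?bnd_simp in y0; lra.
by rewrite /H add0r mul0r => /eqP; rewrite subr_eq0 => /eqP.
Qed.

(** The substitution turns the left side into [(F (k + c) - F c) / k], and an antiderivative gains
    the same amount [F 1 - F 0] over each of the [k] periods, wherever they start. *)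
Lemma integral_periodic (R : realType) (g : R -> R) (k : nat) (c : R) :
  continuous g -> (forall x, g (x + 1) = g x) -> (0 < k)%N -> 0 <= c ->
  (\int[lebesgue_measure]_(x in `[0%R, 1%R]) (g (k%:R * x + c))%:E =
   \int[lebesgue_measure]_(x in `[0%R, 1%R]) (g x)%:E)%E.
Proof.
move=> cg pg k0 c0; have [F [F' FE]] := periodic_antiderivative cg pg.
have k1 : 1 <= k%:R :> R by rewrite ler1n.
have FEk m : F (m%:R + c) - F c = m%:R * (F 1 - F 0).
  elim: m => [|m IH]; first by rewrite add0r subrr mul0r.
  rewrite -natr1 mulrDl mul1r -IH -(FE (m%:R + c)) ?addr_ge0//.
  by rewrite (addrAC _ 1); ring.
pose G (j : nat) (d : R) x := F (j%:R * x + d) / j%:R.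
have GE (j : nat) d : (0 < j)%N -> 0 <= d ->
    (\int[lebesgue_measure]_(x in `[0%R, 1%R]) (g (j%:R * x + d))%:E =
     (F (j%:R + d) / j%:R - F d / j%:R)%:E)%E.
  move=> j0 d0; have j1 : 1 <= j%:R :> R by rewrite ler1n.
  (* The domain where [F] is known to be differentiable, pulled back; it contains a neighbourhood of
     0. *)
  have pos x : - j%:R^-1 < x -> -1 < j%:R * x + d.
    move=> x0; have : j%:R * x > j%:R * (- j%:R^-1) by rewrite ltr_pM2l; lra.
    rewrite mulrN divff; last by apply/eqP; lra.
    by move=> ?; lra.
  have G' (x : R) : - j%:R^-1 < x -> is_derive x (1 : R) (G j d) (g (j%:R * x + d)).
    move=> /pos xp; have Fx := F' _ xp.
    have -> : g (j%:R * x + d) = j%:R^-1 * (g (j%:R * x + d) * j%:R).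
      by rewrite mulrCA mulVf ?mulr1//; apply/eqP; lra.
    rewrite (_ : G j d = j%:R^-1 \*: (F \o (fun x => j%:R * x + d))); last first.
      by apply/funext => y; rewrite /G/= mulrC.
    apply: is_deriveZ; apply: is_derive1_comp => //.
    by apply: is_derive_eq; rewrite addr0 [_%:A]mulr1.
  have cG x : - j%:R^-1 < x -> {for x, continuous (G j d)}.
    move=> y1; apply/differentiable_continuous/derivable1_diffP.
    by have [] := G' _ y1.
  have jN : - j%:R^-1 < 0 :> R by rewrite oppr_lt0 invr_gt0; lra.
  rewrite (@continuous_FTC2 R (fun x => g (j%:R * x + d)) (G j d)) ?ltr01//.
  - by rewrite /G mulr0 add0r mulr1.
  - apply: (@continuous_subspaceT _ _ _ (g \o (fun x => j%:R * x + d))) => x.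
    apply: continuous_comp; last exact: cg.
    apply: cvgD; last exact: cvg_cst.
    by apply: cvgM; [exact: cvg_cst|exact: cvg_id].
  - split.
    + move=> x; rewrite in_itv/= => /andP[x0 _].
      by have [] := G' x (lt_trans jN x0).
    + apply: cvg_at_right_filter; exact: cG.
    + apply: cvg_at_left_filter; apply: cG; lra.
  - move=> x; rewrite in_itv/= => /andP[x0 _].
    by have [_ <-] := G' x (lt_trans jN x0); rewrite derive1E.
(* The right side is the same formula with factor 1 and shift 0. *)
under [RHS]eq_integral do rewrite -[X in g X]mul1r -[X in g X]addr0.
rewrite GE// (GE 1%N)// addr0 -mulrBl FEk !divr1 mulrAC divff ?mul1r//.
by apply/eqP; lra.
Qed.

(** * The logarithmic mean of a linear factor *)

Lemma normc_circle_point (R : realType) (t : R) : normc (circle_point t) = 1.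
Proof. by rewrite /= cos2Dsin2 sqrtr1. Qed.

Lemma circle_pointD1 (R : realType) (t : R) :
  circle_point (t + 1) = circle_point t.
Proof.
rewrite /circle_point (_ : 2 * pi * (t + 1) = 2 * pi * t + pi + pi); last by ring.
by rewrite !cosDpi !sinDpi !opprK.
Qed.

Lemma circle_pointDhalf (R : realType) (t : R) :
  circle_point (t + 2^-1) = - circle_point t.
Proof.
rewrite /circle_point (_ : 2 * pi * (t + 2^-1) = 2 * pi * t + pi); last by field.
by rewrite cosDpi sinDpi.
Qed.

Lemma circle_point_double (R : realType) (t : R) :
  circle_point (2 * t) = circle_point t ^+ 2.
Proof.
rewrite /circle_point expr2 (_ : 2 * pi * (2 * t) = 2 * pi * t + 2 * pi * t); last by ring.
rewrite cosD sinD; congr (_ +i* _); ring.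
Qed.

Lemma continuous_circle_dist (R : realType) (al : R[i]) :
  continuous (fun t : R => normc (circle_point t - al)).
Proof.
case: al => a b x /=.
have lin : {for x, continuous (fun t : R => 2 * pi * t)}.
  by apply: cvgM; [exact: cvg_cst|exact: cvg_id].
have cc : {for x, continuous (fun t : R => cos (2 * pi * t))}.
  by apply: (@continuous_comp _ _ _ (fun t : R => 2 * pi * t)) => //; exact: continuous_cos.
have cs : {for x, continuous (fun t : R => sin (2 * pi * t))}.
  by apply: (@continuous_comp _ _ _ (fun t : R => 2 * pi * t)) => //; exact: continuous_sin.
apply: (@continuous_comp _ _ _
  (fun t : R => (cos (2 * pi * t) - a) ^+ 2 + (sin (2 * pi * t) - b) ^+ 2)); last first.
  exact: sqrt_continuous.
by apply: cvgD; apply: cvgM; apply: cvgB => //; exact: cvg_cst.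
Qed.

Lemma normc_ge0 (R : realType) (z : R[i]) : 0 <= normc z.
Proof. by case: z => a b; exact: sqrtr_ge0. Qed.

Lemma normc_gt0 (R : realType) (z : R[i]) : (0 < normc z) = (z != 0).
Proof.
rewrite lt_neqAle normc_ge0 andbT eq_sym; congr (~~ _); apply/eqP/eqP.
  exact: eq0_normc.
by move=> ->; exact: normc0.
Qed.

Lemma normc_distC (R : realType) (x y : R[i]) : normc (x - y) = normc (y - x).
Proof. by rewrite -(opprB x y); exact/esym/(@normcN R). Qed.

Lemma normcB_le (R : realType) (x y : R[i]) : normc (x - y) <= normc x + normc y.
Proof. by rewrite -[X in _ <= _ + X](@normcN R); exact: (@le_normcD R). Qed.

Lemma normcB_ge (R : realType) (x y : R[i]) : normc x - normc y <= normc (x - y).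
Proof. by have := @le_normcD R (x - y) y; rewrite subrK; lra. Qed.

Lemma normcX (R : realType) (x : R[i]) n : normc (x ^+ n) = normc x ^+ n.
Proof. by elim: n => [|n IH]; rewrite ?expr0 ?normc1// !exprS normcM IH. Qed.

Lemma circle_dist_ge (R : realType) (al : R[i]) (t : R) :
  1 - normc al <= normc (circle_point t - al).
Proof. by rewrite -(normc_circle_point t); exact: normcB_ge. Qed.

Lemma continuous_ln_circle_dist (R : realType) (al : R[i]) : normc al < 1 ->
  continuous (fun t : R => ln (normc (circle_point t - al))).
Proof.
move=> al1 t; apply: (@continuous_comp _ _ _ (fun t => normc (circle_point t - al))).
  exact: continuous_circle_dist.
by apply: continuous_ln; rewrite (lt_le_trans _ (circle_dist_ge _ _))// subr_gt0.
Qed.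

(** The distance lies between [1 - r] and [1 + r], and [1 + r <= 1 / (1 - r)]. The bound is uniform
    in [al], so it applies to all powers of a point at once. *)
Lemma abs_ln_circle_dist (R : realType) (al : R[i]) (r t : R) :
  normc al <= r -> r < 1 ->
  `|ln (normc (circle_point t - al))| <= - ln (1 - r).
Proof.
move=> alr r1; have r1' : 0 < 1 - r by rewrite subr_gt0.
have dr : 1 - r <= normc (circle_point t - al).
  by apply: le_trans (circle_dist_ge _ _); rewrite lerD2l lerN2.
have d0 : 0 < normc (circle_point t - al) by exact: lt_le_trans dr.
rewrite ler_norml opprK ler_ln ?posrE// dr/= -lnV ?posrE// ler_ln ?posrE ?invr_gt0//.
apply: (le_trans (normcB_le _ _)); rewrite normc_circle_point.
apply: (@le_trans _ _ (1 + r)); first by rewrite lerD2l.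
rewrite -div1r ler_pdivlMr//; have := sqr_ge0 r; nra.
Qed.

Lemma normc_sqr_lt1 (R : realType) (al : R[i]) : normc al < 1 -> normc (al ^+ 2) < 1.
Proof. by move=> al1; rewrite normcX expr_lt1// normc_ge0. Qed.

Lemma integrable_ln_circle_dist (R : realType) (al : R[i]) : normc al < 1 ->
  lebesgue_measure.-integrable `[0%R, 1%R]
    (fun t : R => (ln (normc (circle_point t - al)))%:E).
Proof.
move=> al1; apply: continuous_compact_integrable; first exact: segment_compact.
by apply: continuous_subspaceT; exact: continuous_ln_circle_dist.
Qed.

(** Doubling the angle preserves the integral and replaces [z] by [z ^+ 2], which splits the factor.
    A half turn changes [z - al] into [z + al] up to sign, so both factors have the same
    integral. *)
Lemma integral_ln_circle_dist_sqr (R : realType) (al : R[i]) : normc al < 1 ->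
  (\int[lebesgue_measure]_(t in `[0%R, 1%R])
     (ln (normc (circle_point t - al ^+ 2)))%:E
   = (\int[lebesgue_measure]_(t in `[0%R, 1%R])
        (ln (normc (circle_point t - al)))%:E) *+ 2)%E.
Proof.
move=> al1; have al2 := normc_sqr_lt1 al1.
have periodic b x :
    ln (normc (circle_point (x + 1) - b)) = ln (normc (circle_point x - b)) :> R.
  by rewrite circle_pointD1.
rewrite -(integral_periodic (k := 2) (c := 0)
  (continuous_ln_circle_dist al2) (periodic _))//.
have shift := integral_periodic (k := 1) (c := 2^-1)
  (continuous_ln_circle_dist al1) (periodic _).
rewrite mule2n -[X in (_ = _ + X)%E]shift// ?invr_ge0// -integralD//; first last.
- have := integrable_ln_circle_dist (al := - al); rewrite -(@normcN R) in al1.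
  move=> /(_ al1).
  have -> : (fun t : R => (ln (normc (circle_point t - - al)))%:E) =
     (fun x : R => (ln (normc (circle_point (1 * x + 2^-1) - al)))%:E) => //.
  apply/funext => x; rewrite mul1r circle_pointDhalf; congr (ln _)%:E.
  by rewrite -[LHS](@normcN R); congr normc; ring.
- exact: integrable_ln_circle_dist.
apply: eq_integral => t _; rewrite addr0 circle_point_double mul1r circle_pointDhalf.
rewrite -EFinD; congr _%:E; have d0 s : 0 < normc (circle_point s - al).
  by rewrite (lt_le_trans _ (circle_dist_ge _ _))// subr_gt0.
rewrite subr_sqr normcM.
rewrite (_ : normc (circle_point t + al) = normc (- circle_point t - al)); last first.
  by rewrite -[LHS](@normcN R) opprD.
by rewrite lnM// posrE -?circle_pointDhalf.
Qed.

(** Repeated squaring multiplies the integral by [2 ^ n], while the points [al ^+ (2 ^ n)] stay in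
    the disc of radius [normc al], where the integral is bounded. *)
Lemma integral_ln_circle_dist_lt1 (R : realType) (al : R[i]) : normc al < 1 ->
  (\int[lebesgue_measure]_(t in `[0%R, 1%R]) (ln (normc (circle_point t - al)))%:E
   = 0)%E.
Proof.
move=> al1; pose I (b : R[i]) :=
  (\int[lebesgue_measure]_(t in `[0%R, 1%R]) (ln (normc (circle_point t - b)))%:E)%E.
have alX n : normc (al ^+ (2 ^ n)) <= normc al.
  rewrite normcX -[leRHS]expr1; apply: ler_wiXn2l; rewrite ?normc_ge0 ?(ltW al1)//.
  by rewrite expn_gt0.
have IX n : I (al ^+ (2 ^ n)) = ((2 ^+ n)%:E * I al)%E.
  elim: n => [|n IH]; first by rewrite expr1 mul1e.
  rewrite expnSr exprM /I integral_ln_circle_dist_sqr ?(le_lt_trans (alX n))//.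
  by rewrite -/(I _) IH exprS EFinM -muleA mule_natl.
have Ifin : I al \is a fin_num.
  by apply: integrable_fin_num => //; exact: integrable_ln_circle_dist.
have bound n : `|2 ^+ n * fine (I al)| <= - ln (1 - normc al).
  rewrite -lee_fin -abse_EFin EFinM fineK// -IX.
  have int := integrable_ln_circle_dist (le_lt_trans (alX n) al1).
  apply: (le_trans (le_abse_integral _ _ (measurable_int _ int))) => //.
  apply: (@le_trans _ _ (\int[@lebesgue_measure R]_(t in `[0%R, 1%R])
      (- ln (1 - normc al))%:E)%E).
    apply: le_integral => //; first exact: integrable_abse.
      apply: continuous_compact_integrable; first exact: segment_compact.
      by apply: continuous_subspaceT => ?; exact: cvg_cst.
    by move=> t _; rewrite lee_fin abs_ln_circle_dist.
  by rewrite integral_cst//= lebesgue_measure_itv/= lte_fin ltr01 sube0 mule1.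
rewrite -/(I al) -(fineK Ifin); congr _%:E; apply/eqP; apply/contraT => I0.
have I0' : 0 < `|fine (I al)| by rewrite normr_gt0.
pose B := - ln (1 - normc al).
(* Some natural number [n] exceeds [B / |I al|], and [n < 2 ^ n] contradicts the bound at that
   [n]. *)
have := bound (Num.bound (B / `|fine (I al)|)).
rewrite leNgt normrM ger0_norm ?exprn_ge0// -ltr_pdivrMr// => /negP[].
have B0 : 0 <= B / `|fine (I al)|.
  by rewrite divr_ge0// (le_trans _ (bound 0%N)).
apply: (lt_trans (archi_boundP B0)); rewrite -natrX ltr_nat; exact: ltn_expl.
Qed.

(** * The extended logarithm and roots on the circle *)

Lemma measurable_lne_EFin (R : realType) :
  measurable_fun [set: R] (fun x : R => lne x%:E).
Proof.
apply: measurable_fun_ifT => //.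
  exact: measurable_fun_ler.
by apply/measurable_EFinP; exact: measurable_ln.
Qed.

Lemma measurable_lne_circle_dist (R : realType) (al : R[i]) (D : set R) :
  measurable_fun D (fun t : R => lne (normc (circle_point t - al))%:E).
Proof.
apply: measurable_funTS.
apply: (measurableT_comp (@measurable_lne_EFin R)).
by apply: continuous_measurable_fun; exact: continuous_circle_dist.
Qed.

Lemma normc_real (R : realType) (r : R) : 0 <= r -> normc r%:C = r.
Proof. by move=> r0; rewrite /= expr0n/= addr0 sqrtr_sqr ger0_norm. Qed.

(** The limit may be 0, as happens where [circle_point t] meets a root on the circle; the logarithms
    then fall below every [A], since the terms fall below [expR A]. *)
Lemma cvg_lne (R : realType) (u : nat -> R) (l : R) :
  (forall n, 0 < u n) -> u @ \oo --> l -> (fun n => lne (u n)%:E) @ \oo --> lne l%:E.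
Proof.
move=> u0 ul; have l0 : 0 <= l.
  apply: (closed_cvg (fun x : R => 0 <= x)) ul; first exact: closed_ge.
  by apply: nearW => n; exact: ltW.
under eq_fun do rewrite lne_EFin//.
have [l00|l00] := ltP 0 l.
  rewrite lne_EFin//; apply: cvg_EFin; first exact: nearW.
  by apply: (cvg_comp _ _ ul); exact: continuous_ln.
rewrite le0_lneNy//; apply/cvgeNyPle => A.
have := cvgr_lt l ul _ (le_lt_trans l00 (expR_gt0 A)).
move=> uA; near=> n; have unA : u n < expR A by near: n; exact: uA.
by rewrite lee_fin -(expRK A) ler_ln ?posrE ?expR_gt0// ltW.
Unshelve. all: by end_near.
Qed.

(** This bounds the integrand for a boundary root above by the one for the root moved inward, at the
    cost of the constant [- ln r]. *)
Lemma circle_dist_shrink (R : realType) (al : R[i]) (t r : R) :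
  normc al <= 1 -> 0 <= r <= 1 ->
  r * normc (circle_point t - al) <= normc (circle_point t - r%:C * al).
Proof.
move=> al1 /andP[r0 r1].
rewrite -(@ler_pXn2r _ 2%N) ?nnegrE ?mulr_ge0 ?normc_ge0// exprMn.
have : normc al ^+ 2 <= 1 by rewrite expr_le1// normc_ge0.
have := cos2Dsin2 (2 * pi * t).
rewrite /circle_point; move: (cos _) (sin _) => x y xy.
case: al al1 => a b al1.
rewrite /= !sqr_sqrtr ?addr_ge0 ?sqr_ge0// !mul0r subr0 addr0 => ab.
rewrite -subr_ge0.
(* On the circle [(x - a) * x + (y - b) * y] is the real part of 1 minus [al] times the conjugate of
   [z], nonnegative because [al] lies in the closed disc. *)
have -> : (x - r * a) ^+ 2 + (y - r * b) ^+ 2 - r ^+ 2 * ((x - a) ^+ 2 + (y - b) ^+ 2) =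
  (1 - r) * (2 * r * ((x - a) * x + (y - b) * y) + (1 - r) * (x ^+ 2 + y ^+ 2)).
  ring.
rewrite xy mulr1 mulr_ge0 ?subr_ge0// addr_ge0 ?subr_ge0// mulr_ge0 ?mulr_ge0//.
have := addr_ge0 (sqr_ge0 (x - a)) (sqr_ge0 (y - b)); nra.
Qed.

(** The root is approximated by [r k * al] in the open disc. Fatou's lemma gives integrability and
    the bound below by 0; [circle_dist_shrink] gives the bound above. *)
Lemma integral_lne_circle_dist (R : realType) (al : R[i]) : normc al <= 1 ->
  lebesgue_measure.-integrable `[0%R, 1%R]
    (fun t : R => lne (normc (circle_point t - al))%:E) /\
  (\int[lebesgue_measure]_(t in `[0%R, 1%R])
     lne (normc (circle_point t - al))%:E = 0)%E.
Proof.
move=> al1; pose mu := @lebesgue_measure R; pose D : set R := `[0, 1].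
have mD : measurable D by exact: measurable_itv.
pose d (b : R[i]) (t : R) := normc (circle_point t - b).
pose f t := lne (d al t)%:E.
(* With this choice [1 - r k] is [1 / (k + 2)] and [1 / r k - 1] is [1 / (k + 1)], the two errors
   estimated below. *)
pose r (k : nat) : R := k.+1%:R / k.+2%:R; pose be k := (r k)%:C * al.
have rE k : 1 - r k = k.+2%:R^-1.
  rewrite /r -[X in X - _](@divff _ k.+2%:R) ?pnatr_eq0// -mulrBl -[k.+2%:R in LHS]natr1.
  by rewrite addrAC subrr add0r div1r natr1.
have r01 k : 0 < r k < 1.
  by rewrite divr_gt0 ?ltr0n//= -subr_gt0 rE invr_gt0 ltr0n.
have bel k : normc (be k) <= r k.
  have /andP[r0 _] := r01 k; rewrite normcM normc_real ?(ltW r0)//.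
  by rewrite ler_piMr ?(ltW r0).
have be1 k : normc (be k) < 1 by apply: le_lt_trans (bel k) _; have /andP[] := r01 k.
have d_gt0 k t : 0 < d (be k) t.
  by apply: lt_le_trans (circle_dist_ge _ _); rewrite subr_gt0.
have dcvg t : (fun k => d (be k) t) @ \oo --> d al t.
  apply/cvgrPdist_le => e e0.
  have [N _ HN] := near_infty_natSinv_lt (PosNum e0).
  near=> k; apply: (@le_trans _ _ (k.+2%:R^-1)); last first.
    apply: (@le_trans _ _ (k.+1%:R^-1)).
      by rewrite lef_pV2 ?posrE ?ltr0n// ler_nat.
    by apply/ltW/HN; rewrite /=; near: k; exact: nbhs_infty_ge.
  rewrite -rE; have B : normc (be k - al) <= 1 - r k.
    have -> : be k - al = (r k - 1)%:C * al by rewrite rmorphB/= mulrBl mul1r.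
    rewrite normcM -[r k - 1]opprB rmorphN (@normcN R) normc_real; last first.
      by rewrite subr_ge0 ltW//; have /andP[] := r01 k.
    by rewrite ler_piMr// subr_ge0 ltW//; have /andP[] := r01 k.
  have h1 := @le_normcD R (circle_point t - be k) (be k - al).
  have h2 := @le_normcD R (circle_point t - al) (al - be k).
  rewrite addrA subrK in h1; rewrite addrA subrK (normc_distC al) in h2.
  by rewrite ler_norml /d; apply/andP; split; lra.
have d2 b t : normc b <= 1 -> d b t <= 2.
  by move=> b1; apply: (le_trans (normcB_le _ _)); rewrite normc_circle_point; lra.
(* Distances from the circle to the closed disc are at most 2, so these functions are nonnegative,
   as Fatou's lemma requires. *)
pose g k t := ((ln 2)%:E - lne (d (be k) t)%:E)%E.
have g0 k t : (0 <= g k t)%E.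
  rewrite /g lne_EFin// -EFinB lee_fin subr_ge0 ler_ln ?posrE//.
  by rewrite d2// ltW.
have mf : measurable_fun D f by exact: measurable_lne_circle_dist.
have mg k : measurable_fun D (g k).
  apply: emeasurable_funB; first exact: measurable_cst.
  exact: measurable_lne_circle_dist.
have intc (c : R) : (\int[mu]_(x in D) c%:E = c%:E)%E.
  by rewrite integral_cst//= /mu lebesgue_measure_itv/= lte_fin ltr01 sube0 mule1.
have ic (c : R) : mu.-integrable D (fun=> c%:E).
  apply: (@continuous_compact_integrable R (fun=> c)); first exact: (@segment_compact R 0 1).
  by apply: continuous_subspaceT => ?; exact: cvg_cst.
have intlne k : (\int[mu]_(t in D) lne (d (be k) t)%:E = 0)%E.
  rewrite -[RHS](integral_ln_circle_dist_lt1 (be1 k)).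
  by apply: eq_integral => t _; rewrite lne_EFin.
have ilne k : mu.-integrable D (fun t => lne (d (be k) t)%:E).
  have := integrable_ln_circle_dist (be1 k); apply: eq_integrable => //.
  by move=> t _; rewrite lne_EFin.
have intg k : (\int[mu]_(x in D) g k x = (ln 2)%:E)%E.
  by rewrite integralB// intc intlne sube0.
have fatou_g := fatou mu mD mg (fun k x _ => g0 k x).
have lim_intg : limn_einf (fun k => \int[mu]_(x in D) g k x)%E = (ln 2)%:E.
  by under eq_fun do rewrite intg; exact: (cvg_limn_einf_sup (cvg_cst _)).1.
pose h t := ((ln 2)%:E - f t)%E.
have lim_g t : limn_einf (g^~ t) = h t.
  apply: (cvg_limn_einf_sup _).1; apply: cvgeB; last exact: cvg_lne.
  - by rewrite fin_num_adde_defr.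
  - exact: cvg_cst.
have h0 t : (0 <= h t)%E.
  rewrite /h /f; have [dt|dt] := ltP 0 (d al t); last by rewrite le0_lneNy ?lee_fin //= leey.
  by rewrite lne_EFin// -EFinB lee_fin subr_ge0 ler_ln ?posrE// d2.
have mh : measurable_fun D h by apply: emeasurable_funB => //; exact: measurable_cst.
have fatou_h : (\int[mu]_(x in D) h x <= (ln 2)%:E)%E.
  by rewrite -lim_intg; under eq_integral do rewrite -lim_g; exact: fatou_g.
have ih : mu.-integrable D h.
  apply/integrableP; split=> //; under eq_integral do rewrite gee0_abs//.
  exact: le_lt_trans fatou_h (ltry _).
have fE t : f t = ((ln 2)%:E - h t)%E.
  by rewrite /h oppeB ?fin_num_adde_defr// addeA subee// add0e.
have if_ : mu.-integrable D f.
  by rewrite (funext fE : f = _); exact: integrableB.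
split=> //; rewrite -/mu; apply/eqP; rewrite eq_le; apply/andP; split; last first.
  under eq_integral do rewrite -/(f _) fE.
  rewrite integralB// intc sube_ge0; [exact: fatou_h|by rewrite orbT].
(* The upper bound: the integral is at most [- ln (r k)], hence at most [1 / r k - 1], which is
   below [e] for a suitable [k]. *)
apply/lee_addgt0Pr => e e0; rewrite add0e.
have [k _ /(_ k (leqnn k))/= ke] := near_infty_natSinv_lt (PosNum e0).
apply: le_trans (_ : (k.+1%:R^-1)%:E <= _)%E; last by rewrite lee_fin ltW.
have /andP[r0 r1] := r01 k.
apply: (@le_trans _ _ (\int[mu]_(t in D) ((- ln (r k))%:E + lne (d (be k) t)%:E))%E).
  apply: le_integral => //; first exact: integrableD.
  move=> t _; have [dt|dt] := ltP 0 (d al t); last exact: leNye.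
  rewrite !lne_EFin// -EFinD lee_fin -lerBlDl opprK addrC -lnM ?posrE//.
  rewrite ler_ln ?posrE ?mulr_gt0//; apply: circle_dist_shrink => //.
  by rewrite !ltW.
rewrite integralD// intc intlne adde0 lee_fin -lnV ?posrE//.
apply: le_trans (_ : (r k)^-1 - 1 <= _).
  by rewrite -[X in ln X](subrKC 1) le_ln1Dx// ltrBrDl addrN invr_gt0.
by rewrite /r invf_div -[k.+2%:R]natr1 mulrDl divff ?pnatr_eq0// addrAC subrr add0r div1r.
Unshelve. all: by end_near. Qed.

(** * The logarithmic mean of a polynomial *)

Lemma lneM_ge0 (R : realType) (x y : R) : 0 <= x -> 0 <= y ->
  lne (x * y)%:E = (lne x%:E + lne y%:E)%E.
Proof.
rewrite le_eqVlt => /predU1P[<-|x0]; first by rewrite mul0r /= lexx.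
rewrite le_eqVlt => /predU1P[<-|y0]; first by rewrite mulr0 /= lexx addeNy.
by rewrite !lne_EFin ?mulr_gt0// lnM.
Qed.

Lemma horner_prodXsubC (F : comNzRingType) (s : seq F) (z : F) :
  (\prod_(al <- s) ('X - al%:P)).[z] = \prod_(al <- s) (z - al).
Proof. by rewrite horner_prod; apply: eq_bigr => al _; rewrite hornerXsubC. Qed.

Lemma measurable_lne_poly_circle (R : realType) (p : {poly R[i]}) (D : set R) :
  measurable_fun D (fun t : R => lne (normc p.[circle_point t])%:E).
Proof.
apply: measurable_funTS; apply: (measurableT_comp (@measurable_lne_EFin R)).
apply: continuous_measurable_fun; have [s ->] := closed_field_poly_normal p.
have cs : continuous (fun t : R => normc (\prod_(al <- s) (circle_point t - al))).
  elim: s => [|al s IH] t.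
    by under eq_fun do rewrite big_nil; exact: cvg_cst.
  under eq_fun do rewrite big_cons normcM.
  by apply: continuousM; [exact: continuous_circle_dist|exact: IH].
under eq_fun do rewrite hornerZ normcM horner_prodXsubC.
by move=> t; apply: continuousM; [exact: cvg_cst|exact: cs].
Qed.

(** Jensen's formula when every root lies in the closed disc: each linear factor integrates to 0,
    leaving the leading coefficient. *)
Lemma integral_lne_poly_circle (R : realType) (p : {poly R[i]}) : p != 0 ->
  (forall z, root p z -> normc z <= 1) ->
  lebesgue_measure.-integrable `[0%R, 1%R]
    (fun t : R => lne (normc p.[circle_point t])%:E) /\
  (\int[lebesgue_measure]_(t in `[0%R, 1%R]) lne (normc p.[circle_point t])%:E =
   (ln (normc (lead_coef p)))%:E)%E.
Proof.
rewrite -lead_coef_eq0; have [s] := closed_field_poly_normal p.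
move: (lead_coef p) => c -> c0 rp.
have {}rp : forall al, al \in s -> normc al <= 1.
  by move=> al als; apply: rp; rewrite rootZ// root_prod_XsubC.
rewrite (_ : (fun t : R => lne _) = fun t : R =>
    lne (normc c * normc (\prod_(al <- s) (circle_point t - al)))%:E); last first.
  by apply/funext => t; rewrite hornerZ normcM horner_prodXsubC.
elim: s rp => [|al s IH] rp.
  rewrite (_ : (fun t : R => lne _) = fun=> (ln (normc c))%:E); last first.
    by apply/funext => t; rewrite big_nil normc1 mulr1 lne_EFin ?normc_gt0.
  split; last by rewrite integral_cst//= lebesgue_measure_itv/= lte_fin ltr01 sube0 mule1.
  apply: (@continuous_compact_integrable R (fun=> ln (normc c))).
    exact: (@segment_compact R 0 1).
  by apply: continuous_subspaceT => ?; exact: cvg_cst.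
have [i1 I1] := integral_lne_circle_dist (rp al (mem_head _ _)).
have [be bes|i2 I2] := IH; first by apply: rp; rewrite inE bes orbT.
have E t : lne (normc c * normc (\prod_(j <- al :: s) (circle_point t - j)))%:E =
  (lne (normc (circle_point t - al))%:E +
   lne (normc c * normc (\prod_(j <- s) (circle_point t - j)))%:E)%E.
  by rewrite big_cons normcM mulrCA lneM_ge0// ?mulr_ge0 ?normc_ge0.
rewrite (funext E).
split; first exact: integrableD.
by rewrite integralD// I1 I2 add0e.
Qed.

(** Here [f] may have integral -oo, as does the logarithm of the zero polynomial. Positive and
    negative parts are compared separately. *)
Lemma le_integral_integrable_r d (T : measurableType d) (R : realType)
    (mu : {measure set T -> \bar R}) (D : set T) (f g : T -> \bar R) :
  measurable D -> measurable_fun D f -> mu.-integrable D g ->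
  {in D, forall x, (f x <= g x)%E} ->
  (\int[mu]_(x in D) f x <= \int[mu]_(x in D) g x)%E.
Proof.
move=> mD mf /integrableP[mg _] fg; rewrite integralE [leRHS]integralE leeB//.
- apply: ge0_le_integral => //.
  + exact: measurable_funepos.
  + exact: measurable_funepos.
  + by move=> x /mem_set; exact: funepos_le.
- apply: ge0_le_integral => //.
  + exact: measurable_funeneg.
  + exact: measurable_funeneg.
  + by move=> x /mem_set; exact: funeneg_le.
Qed.

(** * Reflecting roots into the disc *)

(** The operator A of the overview: the Euler operator z d/dz conjugated by multiplication by
    z^n. *)
Definition euler_shift (F : fieldType) (n : nat) (p : {poly F}) : {poly F} :=
  'X * p^`() - n%:R *: p.

Lemma coef_euler_shift (F : fieldType) n (p : {poly F}) i :
  (euler_shift n p)`_i = (i%:R - n%:R) * p`_i.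
Proof.
rewrite /euler_shift coefB coefXM coefZ; case: i => [|i] /=.
  by rewrite !sub0r mulNr.
by rewrite coef_deriv mulrBl -[X in X - _]mulr_natl.
Qed.

Lemma deriv_prodXsubC (F : fieldType) (s : seq F) (z : F) : z \notin s ->
  (\prod_(al <- s) ('X - al%:P))^`().[z] =
  (\prod_(al <- s) ('X - al%:P)).[z] * \sum_(al <- s) (z - al)^-1.
Proof.
elim: s => [|al s IH]; first by rewrite !big_nil derivC horner0 mulr0.
rewrite inE negb_or => /andP[zal zs].
rewrite !big_cons derivM derivXsubC mul1r hornerD !hornerM IH// hornerXsubC.
rewrite -subr_eq0 in zal; by field.
Qed.

(* The contribution of one root al of p to z p'(z) / p(z) - (deg p) / 2. *)
Definition root_term (R : realType) (z al : R[i]) : R[i] := z / (z - al) - 2^-1.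

(** This is the logarithmic derivative. The correction is 0 for exactly 2n roots; otherwise it
    counts -1/2 for each root at infinity. *)
Lemma horner_euler_shift (R : realType) n (c z : R[i]) (s : seq R[i]) :
  z \notin s ->
  (euler_shift n (c *: \prod_(al <- s) ('X - al%:P))).[z] =
  (c *: \prod_(al <- s) ('X - al%:P)).[z] *
    (\sum_(al <- s) root_term z al + ((size s)%:R / 2 - n%:R)).
Proof.
move=> zs; rewrite /euler_shift hornerD hornerN hornerM hornerX derivZ !hornerZ.
rewrite deriv_prodXsubC//.
have -> : \sum_(al <- s) root_term z al = z * \sum_(al <- s) (z - al)^-1 - (size s)%:R / 2.
  rewrite big_split/= -mulr_sumr; congr (_ + _).
  by rewrite sumrN big_const_seq count_predT iter_addr_0 mulr_natl.
ring.
Qed.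

Lemma ReD (R : realType) (x y : R[i]) : complex.Re (x + y) = complex.Re x + complex.Re y.
Proof. by case: x y => a b [c d]. Qed.

Lemma ImD (R : realType) (x y : R[i]) : complex.Im (x + y) = complex.Im x + complex.Im y.
Proof. by case: x y => a b [c d]. Qed.

Lemma normc_le_ReIm (R : realType) (x y : R[i]) :
  complex.Im x = complex.Im y -> `|complex.Re x| <= complex.Re y -> normc x <= normc y.
Proof.
case: x y => a b [c d] /= -> ac; apply: ler_wsqrtr; rewrite lerD2r -real_normK ?num_real//.
by rewrite ler_pXn2r ?nnegrE// (le_trans _ ac).
Qed.

Lemma normc_sqr (R : realType) (a b : R) : normc (a +i* b) ^+ 2 = a ^+ 2 + b ^+ 2.
Proof. by rewrite /= sqr_sqrtr// addr_ge0 ?sqr_ge0. Qed.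

(** The term equals half of [(z + al) / (z - al)]; its sign tells which of [z] and [al] is farther
    from 0. *)
Lemma Re_root_term (R : realType) (z al : R[i]) : z != al ->
  complex.Re (root_term z al) =
  (normc z ^+ 2 - normc al ^+ 2) / (2 * normc (z - al) ^+ 2).
Proof.
case: z al => x y [a b]; rewrite -subr_eq0 -normc_gt0 => d0.
have := exprn_gt0 2 d0; rewrite !normc_sqr => d1.
have d2 : (x - a) ^+ 2 + (y - b) ^+ 2 != 0 by rewrite gt_eqF.
have d3 : (2 : R) ^+ 2 + 0 ^+ 2 != 0 by rewrite expr0n addr0 expf_eq0/= pnatr_eq0.
by rewrite /root_term /=; field; exact: d2.
Qed.

Definition reflect_in_disc (R : realType) (al : R[i]) : R[i] :=
  if normc al <= 1 then al else (al^*%C)^-1.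

Lemma normc_conjc (R : realType) (al : R[i]) : normc al^*%C = normc al.
Proof. by case: al => a b /=; rewrite sqrrN. Qed.

Lemma normc_reflect_in_disc (R : realType) (al : R[i]) :
  normc (reflect_in_disc al) <= 1.
Proof.
rewrite /reflect_in_disc; case: (leP (normc al) 1) => // al1.
by rewrite normcV normc_conjc invf_le1 ?(ltW al1)// (lt_trans ltr01 al1).
Qed.

Lemma conjc_unit (R : realType) (z : R[i]) : normc z = 1 -> z^*%C = z^-1.
Proof.
move=> z1; have z0 : z != 0 by rewrite -normc_gt0 z1.
apply: (mulfI z0); rewrite mulfV// -sqr_normc.
by rewrite -[`|z|]/((normc z)%:C) z1 expr1n.
Qed.

(** For [al] outside the disc, conjugate [z - al], use that the conjugate of [z] is [z^-1], and
    factor out the conjugate of [al]. *)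
Lemma normc_dist_reflect (R : realType) (z al : R[i]) : normc z = 1 ->
  normc (z - al) = Num.max 1 (normc al) * normc (z - reflect_in_disc al).
Proof.
move=> z1; rewrite /reflect_in_disc; case: (leP (normc al) 1) => al1; first by rewrite mul1r.
have z0 : z != 0 by rewrite -normc_gt0 z1.
have al0 : al^*%C != 0 by rewrite conjc_eq0 -normc_gt0 (lt_trans ltr01).
rewrite -{1}(normc_conjc al) -normcM mulrBr mulfV//.
rewrite -[LHS]normc_conjc rmorphB/= (conjc_unit z1).
rewrite -[RHS](@normcN R) -[LHS]mul1r -z1 -normcM; congr normc.
by field.
Qed.

Lemma reflect_root_term (R : realType) (z al : R[i]) : normc z = 1 -> z != al ->
  complex.Im (root_term z al) = complex.Im (root_term z (reflect_in_disc al)) /\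
  `|complex.Re (root_term z al)| <= complex.Re (root_term z (reflect_in_disc al)).
Proof.
move=> z1 zal; rewrite /reflect_in_disc; case: (leP (normc al) 1) => al1.
  split=> //; rewrite ger0_norm// Re_root_term//; apply: divr_ge0.
    by rewrite z1 expr1n subr_ge0 expr_le1// normc_ge0.
  by rewrite mulr_ge0 ?sqr_ge0.
have z0 : z != 0 by rewrite -normc_gt0 z1.
have al0 : al^*%C != 0 by rewrite conjc_eq0 -normc_gt0 (lt_trans ltr01).
have zal' : 1 - z * al^*%C != 0.
  apply: contra zal; rewrite subr_eq0 => /eqP e.
  apply/eqP/(can_inj (@conjcK R)); rewrite (conjc_unit z1).
  by apply: (mulfI z0); rewrite mulfV.
(* Negated conjugation keeps the imaginary part and flips the real part, which is nonpositive for a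
   root outside the disc. *)
have E : root_term z (al^*%C)^-1 = - (root_term z al)^*%C.
  have cV (x : R[i]) : (x^-1)^*%C = (x^*%C)^-1 by exact: fmorphV.
  have cB (x y : R[i]) : (x - y)^*%C = x^*%C - y^*%C by exact: rmorphB.
  have cM (x y : R[i]) : (x * y)^*%C = x^*%C * y^*%C by exact: rmorphM.
  have c2 : (2 : R[i])^*%C = 2 by exact: (rmorph_nat _ 2).
  rewrite /root_term cB cM !cV cB c2 (conjc_unit z1); field.
  have zal'' : z * al^*%C - 1 != 0 by rewrite -opprB oppr_eq0.
  by apply/and4P; split=> //; rewrite mulNr mulrC.
rewrite {}E.
have : complex.Re (root_term z al) <= 0.
  rewrite Re_root_term//; apply: mulr_le0_ge0; last by rewrite invr_ge0 mulr_ge0 ?sqr_ge0.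
  by rewrite z1 expr1n subr_le0 expr_ge1 ?normc_ge0// ltW.
by case: (root_term z al) => a b /= a0; rewrite opprK ler0_norm.
Qed.

(* Missing roots, up to degree 2n, count as roots at infinity and move to 0. The
   max factors keep the modulus on the circle unchanged. *)
Definition reflect_poly (R : realType) (n : nat) (c : R[i]) (r : seq R[i]) : {poly R[i]} :=
  (c * (\prod_(al <- r) Num.max 1 (normc al))%:C) *:
    \prod_(al <- map (@reflect_in_disc R) r ++ nseq (n.*2 - size r) 0) ('X - al%:P).

Lemma normc_prod_reflect (R : realType) (r : seq R[i]) (z : R[i]) : normc z = 1 ->
  normc (\prod_(al <- r) (z - al)) =
  \prod_(al <- r) Num.max 1 (normc al) *
    normc (\prod_(al <- map (@reflect_in_disc R) r) (z - al)).
Proof.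
move=> z1; elim: r => [|al r IH]; first by rewrite !big_nil mul1r.
rewrite /= !big_cons !normcM IH normc_dist_reflect//; ring.
Qed.

Lemma prod_max1_gt0 (R : realType) (r : seq R[i]) :
  0 < \prod_(al <- r) Num.max 1 (normc al).
Proof. by apply: prodr_gt0 => al _; rewrite lt_max ltr01. Qed.

Lemma normc_reflect_poly (R : realType) n (c z : R[i]) (r : seq R[i]) : normc z = 1 ->
  normc (reflect_poly n c r).[z] = normc (c *: \prod_(al <- r) ('X - al%:P)).[z].
Proof.
move=> z1; rewrite /reflect_poly !hornerZ !horner_prodXsubC big_cat !normcM.
rewrite (normc_prod_reflect r z1) normc_real ?(ltW (prod_max1_gt0 _))// big_nseq.
rewrite subr0 (_ : normc (iter _ _ _) = 1) ?mulr1 ?mulrA//.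
by elim: (_ - _)%N => [|m IH]; rewrite ?normc1//= normcM z1 IH mulr1.
Qed.

Lemma horner_euler_shift_root (R : realType) n (c z : R[i]) (s : seq R[i]) :
  (euler_shift n (c *: \prod_(al <- z :: s) ('X - al%:P))).[z] =
  z * (c *: \prod_(al <- s) ('X - al%:P)).[z].
Proof.
rewrite big_cons /euler_shift hornerD hornerN hornerM hornerX derivZ !hornerZ.
rewrite derivM derivXsubC mul1r hornerD !hornerM hornerXsubC subrr !mul0r !mulr0.
by rewrite addr0 subr0.
Qed.

(** Each root placed at 0 contributes [1 - 1/2], so [m] of them provide the margin [m / 2] that
    absorbs the roots at infinity. *)
Lemma sum_root_term_reflect (R : realType) (z : R[i]) (r : seq R[i]) m :
  normc z = 1 -> z \notin r ->
  let S := \sum_(al <- r) root_term z al in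
  let S' := \sum_(al <- map (@reflect_in_disc R) r ++ nseq m 0) root_term z al in
  complex.Im S = complex.Im S' /\
  `|complex.Re S| + m%:R / 2 <= complex.Re S'.
Proof.
move=> z1; have z0 : z != 0 by rewrite -normc_gt0 z1.
elim: r => [_|al r IH] /=.
  rewrite big_nil normr0 add0r; elim: m => [|m [IHi IHr]] /=.
    by rewrite big_nil mul0r.
  rewrite big_cons; have -> : root_term z 0 = (2^-1)%:C.
    by rewrite /root_term subr0 divff// rmorphV ?unitfE ?pnatr_eq0// rmorph_nat; field.
  rewrite ReD ImD/= -IHi/= add0r; split=> //.
  by rewrite -natr1 mulrDl div1r addrC lerD2l.
rewrite inE negb_or => /andP[zal zr]; have [Ii Ir] := IH zr.
have [i1 r1] := reflect_root_term z1 zal.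
rewrite !big_cons !(ReD (root_term _ _)) !(ImD (root_term _ _)) i1 Ii; split=> //.
by apply: le_trans (lerD r1 Ir); rewrite addrA lerD2r; exact: ler_normD.
Qed.

(** Off the roots both values are a polynomial of common modulus times a sum of root terms, and
    reflection only enlarges the real part of that sum in absolute value. *)
Lemma euler_shift_reflect_le (R : realType) n (c z : R[i]) (r : seq R[i]) :
  normc z = 1 -> (size r <= n.*2)%N ->
  normc (euler_shift n (c *: \prod_(al <- r) ('X - al%:P))).[z] <=
  normc (euler_shift n (reflect_poly n c r)).[z].
Proof.
move=> z1 rn; have z0 : z != 0 by rewrite -normc_gt0 z1.
have size2n : size (map (@reflect_in_disc R) r ++ nseq (n.*2 - size r) 0) = n.*2.
  by rewrite size_cat size_map size_nseq subnKC.
have [zr|zr] := boolP (z \in r); last first.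
  have zs : z \notin map (@reflect_in_disc R) r ++ nseq (n.*2 - size r) 0.
    rewrite mem_cat mem_nseq negb_or negb_and (negbTE z0) orbT andbT.
    (* A reflected root can equal [z] only if the original root does, as the two distances from [z]
       are proportional. *)
    apply: contra zr => /mapP[al alr zal].
    have := normc_dist_reflect al z1; rewrite -zal subrr normc0 mulr0.
    by move=> /eq0_normc/eqP; rewrite subr_eq0 => /eqP ->.
  rewrite horner_euler_shift// [in leRHS]/reflect_poly horner_euler_shift// size2n.
  rewrite !normcM -/(reflect_poly n c r) normc_reflect_poly//.
  apply: ler_wpM2l; first exact: normc_ge0.
  have [Si Sr] := sum_root_term_reflect (n.*2 - size r) z1 zr.
  have -> : (n.*2)%:R / 2 - n%:R = 0 :> R[i].
    by rewrite -muln2 natrM mulfK ?pnatr_eq0// subrr.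
  rewrite addr0; have -> : (size r)%:R / 2 - n%:R = (- ((n.*2 - size r)%:R / 2))%:C :> R[i].
    have -> : (size r)%:R / 2 - n%:R = ((size r)%:R / 2 - n%:R)%:C :> R[i].
      by rewrite rmorphB rmorphM fmorphV !rmorph_nat.
    by congr _%:C; rewrite natrB// -muln2 natrM; field.
  apply: normc_le_ReIm; first by rewrite ImD/= addr0 Si.
  apply: le_trans Sr; rewrite ReD/=.
  apply: le_trans (ler_normD _ _) _; rewrite lerD2l normrN ger0_norm//.
(* A root on the circle is its own reflection. With one copy of it removed from both products, the
   two moduli coincide. *)
have rp := perm_to_rem zr.
have zz : reflect_in_disc z = z by rewrite /reflect_in_disc z1 lexx.
pose r' := rem z r; pose m := (n.*2 - size r)%N.
rewrite (perm_big _ rp)/= horner_euler_shift_root.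
have -> : reflect_poly n c r = (c * (\prod_(al <- r) Num.max 1 (normc al))%:C) *:
  \prod_(al <- z :: (map (@reflect_in_disc R) r' ++ nseq m 0)) ('X - al%:P).
  rewrite /reflect_poly big_cat big_map [X in _ *: (X * _)](perm_big _ rp) /=.
  by rewrite !big_cons big_cat big_map zz mulrA.
rewrite horner_euler_shift_root (perm_big _ rp)/= big_cons z1 maxxx mul1r.
rewrite !normcM z1 !mul1r !hornerZ !horner_prodXsubC big_cat !normcM.
rewrite (normc_prod_reflect r' z1) normc_real ?(ltW (prod_max1_gt0 _))// big_nseq.
rewrite subr0 (_ : normc (iter _ _ _) = 1) ?mulr1 ?mulrA//.
by elim: m => [|m IH]; rewrite ?normc1//= normcM z1 IH mulr1.
Qed.

Lemma normc_root_reflect_poly (R : realType) (r : seq R[i]) m (al : R[i]) :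
  al \in map (@reflect_in_disc R) r ++ nseq m 0 -> normc al <= 1.
Proof.
rewrite mem_cat => /orP[/mapP[be _ ->]|]; first exact: normc_reflect_in_disc.
by rewrite mem_nseq => /andP[_ /eqP ->]; rewrite normc0.
Qed.

(** * Leading coefficient and roots of the Euler shift *)

Lemma lead_coef_euler_shift (F : numFieldType) n (p : {poly F}) :
  (0 < n)%N -> size p = n.*2.+1 ->
  lead_coef (euler_shift n p) = n%:R * lead_coef p.
Proof.
move=> n0 sp; have p0 : lead_coef p != 0 by rewrite lead_coef_eq0 -size_poly_gt0 sp.
have c2n : (euler_shift n p)`_(n.*2) = n%:R * lead_coef p.
  by rewrite coef_euler_shift lead_coefE sp -addnn natrD addrK.
suff -> : lead_coef (euler_shift n p) = (euler_shift n p)`_(n.*2) by [].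
rewrite lead_coefE; congr (_`_ _); suff -> : size (euler_shift n p) = n.*2.+1 by [].
apply/eqP; rewrite eqn_leq; apply/andP; split.
  by apply/leq_sizeP => j nj; rewrite coef_euler_shift nth_default ?mulr0// sp.
(* The degree does not drop: the coefficient of index 2n is scaled by [2n - n], which is nonzero. *)
rewrite ltnNge; apply/negP => /leq_sizeP/(_ _ (leqnn _))/eqP.
by rewrite c2n mulf_eq0 (negbTE p0) pnatr_eq0 orbF -leqn0 leqNgt n0.
Qed.

(** An argument of Gauss-Lucas type: outside the disc every root term has positive real part, so
    their sum cannot vanish. Positivity of [n] makes the sum nonempty. *)
Lemma root_euler_shift_disc (R : realType) n (c : R[i]) (s : seq R[i]) (z : R[i]) :
  (0 < n)%N -> c != 0 -> size s = n.*2 -> {in s, forall al, normc al <= 1} ->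
  root (euler_shift n (c *: \prod_(al <- s) ('X - al%:P))) z -> normc z <= 1.
Proof.
move=> n0 c0 sn s1 rz; rewrite leNgt; apply/negP => z1.
have zs : z \notin s by apply/negP => /s1; rewrite leNgt z1.
have zal al : al \in s -> z != al by apply: contraTneq => <-.
move: rz; rewrite rootE horner_euler_shift// sn -muln2 natrM mulfK ?pnatr_eq0// subrr addr0.
rewrite hornerZ horner_prodXsubC !mulf_eq0 (negbTE c0)/=.
case/orP => [|/eqP sum0].
  by rewrite prodf_seq_eq0 => /hasP[al als]; rewrite subr_eq0; exact/negP/zal.
suff : 0 < complex.Re (\sum_(al <- s) root_term z al) by rewrite sum0 ltxx.
clear sum0.
have s0 : (0 < size s)%N by rewrite sn double_gt0.
have pos al : al \in s -> 0 < complex.Re (root_term z al).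
  move=> als; rewrite Re_root_term ?zal//; apply: divr_gt0.
    rewrite subr_gt0 (le_lt_trans (_ : _ <= 1))// ?expr_le1 ?s1 ?normc_ge0//.
    by rewrite expr_gt1// normc_ge0.
  by rewrite mulr_gt0// exprn_gt0// normc_gt0 subr_eq0 zal.
case: s s0 pos {sn s1 zs zal} => // al s _ pos.
rewrite big_cons ReD; apply: ltr_pwDl; first by apply: pos; rewrite mem_head.
have {}pos be : be \in s -> 0 < complex.Re (root_term z be).
  by move=> bes; apply: pos; rewrite inE bes orbT.
elim: s pos => [|be s IH] pos; first by rewrite big_nil.
rewrite big_cons ReD addr_ge0//; first by rewrite ltW// pos// mem_head.
by apply: IH => ga gas; apply: pos; rewrite inE gas orbT.
Qed.

(** * Derivatives of trigonometric polynomials *)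

Lemma is_derive_exprz (K : numFieldType) (z : K) (k : int) : z != 0 ->
  is_derive (z : K^o) (1 : K^o) (fun w : K => w ^ k : K^o) (k%:~R * z ^ (k - 1)).
Proof.
move=> z0.
have dX (m : nat) : is_derive (z : K^o) (1 : K^o) ((@id K^o : K^o -> K) ^+ m)
    (m%:R * z ^+ m.-1).
  by have := @is_deriveX K K^o id m z 1 1 (is_derive_id _ _); rewrite [_ *: _]mulr1.
have E (m : nat) : (@id K^o : K^o -> K) ^+ m = (fun w => w ^+ m).
  by apply/funext => w; elim: m => [|m IH]; rewrite ?expr0// !exprS -IH.
case: k => m.
  have := dX m; rewrite E => h; apply: (is_derive_eq h).
  case: m {h} => [|m]; first by rewrite !mul0r.
  by rewrite intS addrAC subrr add0r.
have z1 : ((@id K^o : K^o -> K) ^+ m.+1) z != 0 by rewrite E expf_neq0.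
have [d1 d2] := dX m.+1.
(* [Negz m] stands for [-(m + 1)], so the negative case is the inverse of the power [m.+1]. *)
have E2 : (fun w : K => w ^ Negz m : K^o) =
    (fun w => (((@id K^o : K^o -> K) ^+ m.+1) w)^-1).
  by apply/funext => w; rewrite E.
rewrite E2; apply: DeriveDef; first exact: derivableV.
rewrite deriveV// d2 E NegzE.
have -> : - m.+1%:Z - 1 = - m.+2%:Z by rewrite (intS m.+1) opprD addrC.
rewrite -exprnN rmorphN/= -[_ *: _]/(_ * _) !exprS.
have zm : z ^+ m != 0 by rewrite expf_neq0.
by rewrite -[m.+1%:~R]/(m.+1%:R : K); field; rewrite zm z0.
Qed.

Lemma complex_deriv_trig_poly (R : realType) n (a : int -> R[i]) (z : R[i]) : z != 0 ->
  complex_deriv (trig_poly n a) z =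
  \sum_(j < n.*2.+1) a (j%:Z - n%:Z) * ((j%:Z - n%:Z)%:~R * z ^ (j%:Z - n%:Z - 1)).
Proof.
move=> z0; rewrite /complex_deriv derive1E.
pose h (j : 'I_n.*2.+1) : R[i] -> R[i]^o :=
  a (j%:Z - n%:Z) \*: (fun w : R[i] => w ^ (j%:Z - n%:Z) : R[i]^o).
have -> : (trig_poly n a : R[i] -> R[i]^o) = \sum_(j < n.*2.+1) h j.
  by apply/funext => w; rewrite fct_sumE.
have hd j := is_deriveZ (a (j%:Z - n%:Z)) (is_derive_exprz (j%:Z - n%:Z) z0).
by have [_ ->] := @is_derive_sum R[i] R[i]^o R[i]^o _ h z 1 _ (fun j => hd j).
Qed.

(** The polynomial p = z^n T of the overview. *)
Definition shifted_poly (R : realType) n (a : int -> R[i]) : {poly R[i]} :=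
  \poly_(j < n.*2.+1) a (j%:Z - n%:Z).

Lemma trig_polyE (R : realType) n (a : int -> R[i]) (z : R[i]) : z != 0 ->
  trig_poly n a z = z ^- n * (shifted_poly n a).[z].
Proof.
move=> z0; rewrite /trig_poly horner_poly mulr_sumr; apply: eq_bigr => j _.
by rewrite expfzDr// -exprnN -exprnP; ring.
Qed.

(** Passing to the reflected polynomial [q] can only increase the left side and keeps the integral
    of log|p|. Jensen's formula for [q] and its Euler shift then reduces the claim to their leading
    coefficients, of ratio [n]. *)
Lemma integral_lne_euler_shift (R : realType) n (p : {poly R[i]}) :
  (0 < n)%N -> (size p <= n.*2.+1)%N ->
  (\int[lebesgue_measure]_(t in `[0%R, 1%R])
     lne (normc (euler_shift n p).[circle_point t])%:E
   <= lne n%:R%:E +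
     \int[lebesgue_measure]_(t in `[0%R, 1%R]) lne (normc p.[circle_point t])%:E)%E.
Proof.
move=> n0; have nR0 : 0 < n%:R :> R by rewrite ltr0n.
(* For the zero polynomial both sides are -oo. *)
have [->|p0] := eqVneq p 0.
  have e (q : {poly R[i]}) : q = 0 -> (\int[@lebesgue_measure R]_(t in `[0%R, 1%R])
      lne (normc q.[circle_point t])%:E = -oo)%E.
    move=> ->; under eq_integral do rewrite horner0 normc0 le0_lneNy//.
    by rewrite integral_cst//= lebesgue_measure_itv/= lte_fin ltr01 sube0 mule1.
  have -> : euler_shift n (0 : {poly R[i]}) = 0.
    by rewrite /euler_shift derivC mulr0 scaler0 subr0.
  by move=> _; rewrite (e 0)// addeNy.
have [r pr] := closed_field_poly_normal p.
have c0 : lead_coef p != 0 by rewrite lead_coef_eq0.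
rewrite {1}pr size_scale// size_prod_XsubC ltnS => rn.
move: (lead_coef p) c0 pr => c c0 ->.
pose s := map (@reflect_in_disc R) r ++ nseq (n.*2 - size r) 0.
have sn : size s = n.*2 by rewrite size_cat size_map size_nseq subnKC.
pose q := reflect_poly n c r.
have c'0 : c * (\prod_(al <- r) Num.max 1 (normc al))%:C != 0.
  by rewrite mulf_neq0// -normc_gt0 normc_real ?prod_max1_gt0// ltW ?prod_max1_gt0.
have s1 : {in s, forall al, normc al <= 1}.
  by move=> al; exact: normc_root_reflect_poly.
have q0 : q != 0 by rewrite scaler_eq0 negb_or c'0 monic_neq0 ?monic_prod_XsubC.
have sq : size q = n.*2.+1 by rewrite size_scale// size_prod_XsubC sn.
have Lq : lead_coef (euler_shift n q) = n%:R * lead_coef q by exact: lead_coef_euler_shift.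
have Eq0 : euler_shift n q != 0.
  by rewrite -lead_coef_eq0 Lq mulf_neq0 ?lead_coef_eq0// pnatr_eq0 -lt0n.
have rq z : root q z -> normc z <= 1.
  by rewrite rootZ// root_prod_XsubC; exact: s1.
have [_ Iq] := integral_lne_poly_circle q0 rq.
have [iEq IEq] := integral_lne_poly_circle Eq0
  (fun z => root_euler_shift_disc n0 c'0 sn s1).
apply: (@le_trans _ _ (\int[lebesgue_measure]_(t in `[0%R, 1%R])
    lne (normc (euler_shift n q).[circle_point t])%:E)%E).
  apply: le_integral_integrable_r => //; first exact: measurable_lne_poly_circle.
  move=> t _; rewrite lee_lne ?in_itv/= ?leey ?lee_fin ?normc_ge0//.
  by apply: euler_shift_reflect_le => //; exact: normc_circle_point.
rewrite IEq Lq normcM lnM ?posrE ?normc_gt0 ?pnatr_eq0 ?lead_coef_eq0 -?lt0n//.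
rewrite (_ : normc n%:R = n%:R); last first.
  by rewrite -(rmorph_nat (real_complex R)) normc_real.
rewrite EFinD lne_EFin// -Iq leeD2l// le_eqVlt; apply/orP; left; apply/eqP.
by apply: eq_integral => t _; rewrite normc_reflect_poly// normc_circle_point.
Qed.

(** The derivative of T is z^(-n-1) times the Euler shift of z^n T, and the power of z has modulus
    1. *)
Lemma normc_deriv_trig_poly (R : realType) n (a : int -> R[i]) (t : R) :
  normc (complex_deriv (trig_poly n a) (circle_point t)) =
  normc (euler_shift n (shifted_poly n a)).[circle_point t].
Proof.
have z1 := normc_circle_point t; move: (circle_point t) z1 => z z1.
have z0 : z != 0 by rewrite -normc_gt0 z1.
rewrite complex_deriv_trig_poly//.
have -> : \sum_(j < n.*2.+1) a (j%:Z - n%:Z) * ((j%:Z - n%:Z)%:~R * z ^ (j%:Z - n%:Z - 1)) =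
   z ^- n.+1 * (euler_shift n (shifted_poly n a)).[z].
  rewrite (@horner_coef_wide _ n.*2.+1); last first.
    apply/leq_sizeP => j nj; rewrite coef_euler_shift nth_default ?mulr0//.
    exact: leq_trans (size_poly _ _) nj.
  rewrite mulr_sumr; apply: eq_bigr => j _.
  rewrite coef_euler_shift coef_poly ltn_ord.
  have -> : j%:Z - n%:Z - 1 = j%:Z - n.+1%:Z by rewrite intS opprD addrA addrAC.
  rewrite expfzDr// -exprnN -exprnP rmorphB/=.
  rewrite -[j%:~R]/(j%:R : R[i]) -[n%:~R]/(n%:R : R[i]); ring.
by rewrite normcM normcV normcX z1 expr1n invr1 mul1r.
Qed.

Theorem theorem5p2 (R : realType) (n : nat) (a : int -> R[i]) :
  (mahler_norm (complex_deriv (trig_poly n a))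
     <= n%:R%:E * mahler_norm (trig_poly n a))%E.
Proof.
rewrite /mahler_norm; under eq_integral do rewrite normc_deriv_trig_poly.
(* For [n = 0] the Euler shift is zero, its logarithm is -oo everywhere, and both sides of the
   inequality are 0. *)
case: n => [|n].
  have -> : euler_shift 0 (shifted_poly 0 a) = 0.
    apply/polyP => -[|i]; rewrite coef_euler_shift coef0 ?subrr ?mul0r//.
    by rewrite coef_poly mulr0.
  under eq_integral do rewrite horner0 normc0 le0_lneNy//.
  by rewrite integral_cst//= lebesgue_measure_itv/= lte_fin ltr01 sube0 mule1 mul0e.
have tE t : normc (trig_poly n.+1 a (circle_point t)) =
    normc (shifted_poly n.+1 a).[circle_point t] :> R.
  have z1 := normc_circle_point t.
  rewrite trig_polyE -?normc_gt0 ?z1// normcM normcV normcX z1.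
  by rewrite expr1n invr1 mul1r.
under [X in (_ <= _ * expeR X)%E]eq_integral do rewrite tE.
(* Writing the degree as an exponential reduces the claim to an inequality between exponents. *)
have -> : (n.+1%:R%:E = expeR (lne n.+1%:R%:E) :> \bar R)%E.
  by rewrite lneK// in_itv/= leey lee_fin ler0n.
rewrite -expeRD lee_expeR.
exact: integral_lne_euler_shift (size_poly _ _).
Qed.
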